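(* Let $f\in\mathrm{F}$ and $(\tau,\xi)\in\mathbb{R}^2$ be such that $f(\tau,\xi)>0$. Then there exists precisely one maximal solution $\varphi$ of the initial value problem $x'=f(t,x)$, $x(\tau)=\xi$. This unique solution is a strictly increasing and bijective path in some set $C^1([\tau,T_* ),[\xi,X_* ))$, where $T_*\in(\tau,\infty]$, $X_*\in(\xi,\infty]$ and $T_*\vee X_*=\infty$.
   Context: $\mathrm{F}\subset C(\mathbb{R}^2,\mathbb{R})$ is the set of continuous functions $f:\mathbb{R}^2\to\mathbb{R}$, $(t,x)\mapsto f(t,x)$, such that $f(\cdot,x)$ is strictly increasing for every $x\in\mathbb{R}$, and $f(\tau,\xi)>0$ for some $(\tau,\xi)\in\mathbb{R}^2$. No regularity beyond continuity is assumed in the variable $x$. A maximal solution of $x'=f(t,x)$, $x(\tau)=\xi$ (going forwards in time) is a path $\varphi\in C^1([\tau,T_* ),\mathbb{R})$ for some $T_*\in(\tau,\infty]$ (with a right derivative at $\tau$) which verifies $\varphi(\tau)=\xi$, $\varphi'(t)=f(t,\varphi(t))$ for every $t\in[\tau,T_* )$, and $T_*\vee\sup_{t\in[\tau,T_* )}|\varphi(t)|=\infty$. Here $a\vee b=\max\{a,b\}$. *)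

(* Defs.v *)
From Stdlib Require Export Reals.
From Coquelicot Require Export Coquelicot.
Open Scope R_scope.

Definition class_F (f : R -> R -> R) : Prop :=
  (forall p : R * R, continuous (fun q : R * R => f (fst q) (snd q)) p) /\
  (forall x, strict_increasing (fun t => f t x)) /\
  (exists tau xi, f tau xi > 0).

(* [a, b), where b may be infinite *)
Definition Ico (a : R) (b : Rbar) (t : R) : Prop := a <= t /\ Rbar_lt t b.

Definition Rbar_max (a b : Rbar) : Rbar := if Rbar_le_dec a b then b else a.

(* A path on a subset D of R is represented by a total function, of which only
   the values on D are relevant: [D_in] and [continue_in] take limits inside D,
   so that, on D = [a, b), they mean the right derivative and right continuity
   at a and the usual (two-sided) notions on (a, b). *)
Definition C1_path (D E : R -> Prop) (phi : R -> R) : Prop :=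
  (forall t, D t -> E (phi t)) /\
  exists dphi : R -> R,
    forall t, D t -> D_in phi dphi D t /\ continue_in dphi D t.

Definition strict_increasing_on (D : R -> Prop) (phi : R -> R) : Prop :=
  forall s t, D s -> D t -> s < t -> phi s < phi t.

Definition bijective_on (D E : R -> Prop) (phi : R -> R) : Prop :=
  (forall t, D t -> E (phi t)) /\
  (forall s t, D s -> D t -> phi s = phi t -> s = t) /\
  (forall x, E x -> exists t, D t /\ phi t = x).

Definition maximal_solution (f : R -> R -> R) (tau xi : R)
    (T : Rbar) (phi : R -> R) : Prop :=
  Rbar_lt tau T /\
  C1_path (Ico tau T) (fun _ => True) phi /\
  phi tau = xi /\
  (forall t, Ico tau T t -> D_in phi (fun s => f s (phi s)) (Ico tau T) t) /\
  Rbar_max T (Lub_Rbar (fun y => exists t, Ico tau T t /\ y = Rabs (phi t)))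
    = p_infty.

(* Main.v *)
(** Comparison with time shifts: if u and v solve the problem and d > 0 is small, then u(tau + d) > xi, and wherever v(s) = u(s + d) the shifted solution
    has the larger derivative, so that v(s) <= u(s + d) throughout.  Letting d -> 0 gives
    uniqueness; taking v = u gives monotonicity of u, which is strict because a
    constant stretch would make f(., x) vanish at two times.  This needs no
    positivity of f along the solution, where f may indeed vanish.

    Local existence is Peano's theorem, proved by Perron's method: for a bounded
    continuous field the supremum of the Lipschitz subsolutions is a solution.

    Let T be the supremum of the existence times and X that of the values.  If both
    were finite, clamping f to a rectangle slightly larger than [tau, T] x [xi, X]
    would give a bounded field, still increasing in time; its solution agrees with
    the maximal one before T by uniqueness, and solves x' = f(t, x) past T. *)

Require Import Defs.
From Stdlib Require Import Reals.
From Coquelicot Require Import Coquelicot.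
From Stdlib Require Import Lra Classical ClassicalEpsilon.
Open Scope R_scope.

(** * Epsilon-delta forms of continuity and differentiability, and comparison with a line *)

Lemma continuous_eps (w : R -> R) (t eps : R) :
  continuous w t -> 0 < eps ->
  exists d, 0 < d /\ forall s, Rabs (s - t) < d -> Rabs (w s - w t) < eps.
Proof.
  intros Hw He.
  destruct (proj1 (filterlim_locally w (w t)) Hw (mkposreal eps He)) as [d Hd].
  exists d; split; [apply cond_pos | exact Hd].
Qed.

Lemma continuous_pos (w : R -> R) (t : R) :
  continuous w t -> 0 < w t ->
  exists d, 0 < d /\ forall s, Rabs (s - t) < d -> 0 < w s.
Proof.
  intros Hw H0.
  destruct (continuous_eps w t (w t) Hw H0) as [d [Hd H]].
  exists d; split; auto.
  intros s Hs. specialize (H s Hs). apply Rabs_def2 in H. lra.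
Qed.

Lemma is_derive_eps (w : R -> R) (t l eps : R) :
  is_derive w t l -> 0 < eps ->
  exists d, 0 < d /\ forall s, Rabs (s - t) < d ->
    Rabs (w s - w t - l * (s - t)) <= eps * Rabs (s - t).
Proof.
  intros Hw He. apply is_derive_Reals in Hw.
  destruct (Hw eps He) as [d Hd].
  exists d; split; [apply cond_pos|]. intros s Hs.
  destruct (Req_dec s t) as [->|Hne].
  { rewrite !Rminus_diag, Rmult_0_r, Rminus_0_r, Rabs_R0. lra. }
  assert (Hn : s - t <> 0) by lra.
  specialize (Hd (s - t) Hn Hs). replace (t + (s - t)) with s in Hd by ring.
  replace (w s - w t - l * (s - t)) with (((w s - w t) / (s - t) - l) * (s - t))
    by (field; auto).
  rewrite Rabs_mult. apply Rmult_le_compat_r; [apply Rabs_pos | lra].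
Qed.

Lemma eps_is_derive (w : R -> R) (t l : R) :
  (forall eps, 0 < eps -> exists d, 0 < d /\ forall s, Rabs (s - t) < d ->
    Rabs (w s - w t - l * (s - t)) <= eps * Rabs (s - t)) ->
  is_derive w t l.
Proof.
  intros H. apply is_derive_Reals. intros eps He.
  destruct (H (eps / 2) ltac:(lra)) as [d [Hd Hs]].
  exists (mkposreal d Hd). intros h Hh Hhd. simpl in Hhd.
  specialize (Hs (t + h)). replace (t + h - t) with h in Hs by ring.
  specialize (Hs Hhd).
  replace ((w (t + h) - w t) / h - l) with ((w (t + h) - w t - l * h) / h)
    by (field; auto).
  rewrite Rabs_div by auto.
  apply Rle_lt_trans with (eps / 2); [|lra].
  apply Rle_div_l; [apply Rabs_pos_lt; auto | exact Hs].
Qed.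

Lemma is_derive_pos_right (w : R -> R) (t l : R) :
  is_derive w t l -> 0 < l ->
  exists d, 0 < d /\ forall s, t < s < t + d -> w t < w s.
Proof.
  intros Hw Hl.
  destruct (is_derive_eps w t l (l / 2) Hw ltac:(lra)) as [d [Hd H]].
  exists d; split; auto. intros s Hs.
  assert (Ha : Rabs (s - t) = s - t) by (apply Rabs_pos_eq; lra).
  specialize (H s). rewrite Ha in H. specialize (H ltac:(lra)).
  apply Rabs_le_between in H. nra.
Qed.

(** The last time [m] at which [u] lies on or below the line satisfies the inequality by continuity.
    If [m < q], the inequality persists beyond [m]: by continuity when it is strict, by the last
    hypothesis at a contact. So the growth of [u] has to be controlled only where it touches the
    line. *)
Lemma barrier (u : R -> R) (c K p q : R) :
  p <= q -> (forall t, p <= t <= q -> continuous u t) -> u p <= c ->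
  (forall t, p <= t < q -> u t = c + K * (t - p) ->
     exists d, 0 < d /\ forall s, t < s < t + d -> u s <= u t + K * (s - t)) ->
  u q <= c + K * (q - p).
Proof.
  intros Hpq Hc Hp Hstep.
  set (w := fun t => c + K * (t - p) - u t).
  assert (Hw : forall t, p <= t <= q -> continuous w t).
  { intros t Ht. unfold w. apply (continuous_minus (fun t => c + K * (t - p)) u).
    - apply (ex_derive_continuous (fun t => c + K * (t - p))). auto_derive; auto.
    - auto. }
  set (E := fun t => p <= t <= q /\ 0 <= w t).
  assert (HEp : E p) by (split; [lra|]; unfold w; lra).
  destruct (completeness E) as [m [Hub Hlub]].
  { exists q. intros t [Ht _]. lra. }
  { exists p; auto. }
  assert (Hpm : p <= m) by (apply Hub; auto).
  assert (Hmq : m <= q) by (apply Hlub; intros t [Ht _]; lra).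
  assert (Hwm : 0 <= w m).
  { destruct (Rle_lt_dec 0 (w m)) as [|Hneg]; auto. exfalso.
    destruct (continuous_pos (fun t => - w t) m) as [d [Hd H]]; [|lra|].
    - apply (continuous_opp w). apply Hw; lra.
    - assert (m <= m - d); [|lra].
      apply Hlub. intros t [Ht Hwt].
      destruct (Rle_lt_dec t (m - d)) as [|Hlt]; auto. exfalso.
      assert (t <= m) by (apply Hub; split; auto).
      specialize (H t). cbv beta in H.
      assert (0 < - w t); [apply H; apply Rabs_def1; lra | lra]. }
  destruct (Rle_lt_dec q m) as [Hqm|Hmlt].
  { replace q with m by lra. unfold w in Hwm. lra. }
  exfalso.
  assert (exists d, 0 < d /\ forall s, m < s < m + d -> 0 <= w s) as [d [Hd H]].
  { destruct Hwm as [Hpos|Hzero].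
    - destruct (continuous_pos w m) as [d [Hd H]]; auto.
      exists d; split; auto. intros s Hs. apply Rlt_le, H. apply Rabs_def1; lra.
    - destruct (Hstep m) as [d [Hd H]]; [lra | unfold w in Hzero; lra |].
      exists d; split; auto. intros s Hs. specialize (H s Hs).
      unfold w in *. lra. }
  set (s := m + Rmin (d / 2) (q - m)).
  assert (0 < Rmin (d / 2) (q - m)) by (apply Rmin_pos; lra).
  assert (Rmin (d / 2) (q - m) <= d / 2) by apply Rmin_l.
  assert (Rmin (d / 2) (q - m) <= q - m) by apply Rmin_r.
  assert (s <= m); [|unfold s in *; lra].
  apply Hub. split; [unfold s; lra | apply H; unfold s; lra].
Qed.

(** * Lipschitz functions *)

Definition lipschitz (M : R) (u : R -> R) : Prop :=
  forall s t, Rabs (u s - u t) <= M * Rabs (s - t).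

Lemma lipschitz_continuous (M : R) (u : R -> R) (t : R) :
  0 < M -> lipschitz M u -> continuous u t.
Proof.
  intros HM Hu. apply filterlim_locally. intros eps.
  assert (Hd : 0 < eps / M) by (apply Rdiv_lt_0_compat; [apply cond_pos | auto]).
  exists (mkposreal _ Hd). intros s Hs.
  change (Rabs (u s - u t) < eps). change (Rabs (s - t) < eps / M) in Hs.
  apply Rle_lt_trans with (1 := Hu s t).
  apply Rlt_div_r in Hs; auto. lra.
Qed.

Lemma lipschitz_upper (M : R) (u : R -> R) (s t : R) :
  lipschitz M u -> u s <= u t + M * Rabs (s - t).
Proof. intros Hu. specialize (Hu s t). apply Rabs_le_between in Hu. lra. Qed.

Lemma upper_lipschitz (M : R) (u : R -> R) :
  (forall s t, u s <= u t + M * Rabs (s - t)) -> lipschitz M u.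
Proof.
  intros H s t. apply Rabs_le. split.
  - specialize (H t s). rewrite Rabs_minus_sym in H. lra.
  - specialize (H s t). lra.
Qed.

Lemma lipschitz_affine (M k y0 t0 : R) :
  Rabs k <= M -> lipschitz M (fun t => y0 + k * (t - t0)).
Proof.
  intros Hk s t.
  replace (y0 + k * (s - t0) - (y0 + k * (t - t0))) with (k * (s - t)) by ring.
  rewrite Rabs_mult. apply Rmult_le_compat_r; [apply Rabs_pos | auto].
Qed.

Lemma lipschitz_max (M : R) (u v : R -> R) :
  lipschitz M u -> lipschitz M v -> lipschitz M (fun t => Rmax (u t) (v t)).
Proof.
  intros Hu Hv. apply upper_lipschitz. intros s t.
  assert (H1 := lipschitz_upper M u s t Hu). assert (H2 := lipschitz_upper M v s t Hv).
  assert (H3 := Rmax_l (u t) (v t)). assert (H4 := Rmax_r (u t) (v t)).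
  apply Rmax_lub; lra.
Qed.

Lemma lipschitz_min (M : R) (u v : R -> R) :
  lipschitz M u -> lipschitz M v -> lipschitz M (fun t => Rmin (u t) (v t)).
Proof.
  intros Hu Hv. apply upper_lipschitz. intros s t.
  assert (H1 := lipschitz_upper M u s t Hu). assert (H2 := lipschitz_upper M v s t Hv).
  assert (H3 := Rmin_l (u s) (v s)). assert (H4 := Rmin_r (u s) (v s)).
  destruct (Rmin_case_strong (u t) (v t) (fun z => Rmin (u s) (v s) <= z + M * Rabs (s - t)));
  lra.
Qed.

(** Near [t0] the right derivative [G] is within [eps / 2] of [G t0]. The barrier lemma for [u] and
    [- u] turns this into a bound on increments over every small interval near [t0], including those
    that end at [t0]; this controls the left difference quotients too. *)
Lemma right_derivative_is_derive (M : R) (u G : R -> R) (t0 : R) :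
  0 < M -> lipschitz M u -> continuous G t0 ->
  (forall t eps, 0 < eps -> exists d, 0 < d /\ forall s, t < s < t + d ->
     Rabs (u s - u t - G t * (s - t)) <= eps * (s - t)) ->
  is_derive u t0 (G t0).
Proof.
  intros HM Hu HG Hr. apply eps_is_derive. intros eps He.
  destruct (continuous_eps G t0 (eps / 2) HG ltac:(lra)) as [d [Hd H]].
  assert (Hinc : forall p q, p <= q -> t0 - d < p -> q < t0 + d ->
    Rabs (u q - u p - G t0 * (q - p)) <= eps * (q - p)).
  { intros p q Hpq Hp Hq.
    assert (Hloc : forall t, p <= t < q -> exists d, 0 < d /\ forall s, t < s < t + d ->
       Rabs (u s - u t - G t0 * (s - t)) <= eps * (s - t)).
    { intros t Ht. destruct (Hr t (eps / 2) ltac:(lra)) as [d' [Hd' H']].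
      exists d'; split; auto. intros s Hs. specialize (H' s Hs).
      assert (HGt : Rabs (G t - G t0) < eps / 2) by (apply H; apply Rabs_def1; lra).
      apply Rabs_def2 in HGt. apply Rabs_le_between in H'. apply Rabs_le. nra. }
    assert (B1 := barrier u (u p) (G t0 + eps) p q Hpq).
    assert (B2 := barrier (fun t => - u t) (- u p) (- G t0 + eps) p q Hpq).
    apply Rabs_le. split.
    - cut (- u q <= - u p + (- G t0 + eps) * (q - p)); [lra|]. apply B2; [|lra|].
      + intros t _. apply (continuous_opp u). apply (lipschitz_continuous M); auto.
      + intros t Ht _. destruct (Hloc t Ht) as [d' [Hd' H']].
        exists d'; split; auto. intros s Hs. specialize (H' s Hs).
        apply Rabs_le_between in H'. lra.
    - cut (u q <= u p + (G t0 + eps) * (q - p)); [lra|]. apply B1; [|lra|].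
      + intros t _. apply (lipschitz_continuous M); auto.
      + intros t Ht _. destruct (Hloc t Ht) as [d' [Hd' H']].
        exists d'; split; auto. intros s Hs. specialize (H' s Hs).
        apply Rabs_le_between in H'. lra. }
  exists d; split; auto. intros s Hs. apply Rabs_def2 in Hs.
  destruct (Rle_lt_dec t0 s) as [Hle|Hlt].
  - rewrite (Rabs_pos_eq (s - t0)) by lra. apply Hinc; lra.
  - rewrite (Rabs_minus_sym s t0), (Rabs_pos_eq (t0 - s)) by lra.
    replace (u s - u t0 - G t0 * (s - t0)) with (- (u t0 - u s - G t0 * (t0 - s))) by ring.
    rewrite Rabs_Ropp. apply Hinc; lra.
Qed.

(** * Peano's theorem by Perron's method *)

(* The last clause bounds the upper right Dini derivative of [u] by [g t (u t)]. *)
Definition subsolution (g : R -> R -> R) (M a x0 : R) (u : R -> R) : Prop :=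
  u a = x0 /\ lipschitz M u /\
  forall t eps, a <= t -> 0 < eps ->
    exists d, 0 < d /\ forall s, t < s < t + d ->
      u s <= u t + (g t (u t) + eps) * (s - t).

(** The neighbourhood is a cone of slope [M] opening to the right, in which lines of slope at most
    [M] through [(t, x)] remain; up to time [Rmin r (r / M)] it fits into the square of radius
    [r]. *)
Lemma bounded_near (g : R -> R -> R) (t x eps M : R) :
  continuity_2d_pt g t x -> 0 < eps -> 0 < M ->
  exists h, 0 < h /\ forall s y, t <= s < t + h -> Rabs (y - x) <= M * (s - t) ->
    Rabs (g s y - g t x) < eps.
Proof.
  intros Hg He HM. destruct (Hg (mkposreal eps He)) as [[r Hr] H]. simpl in H.
  exists (Rmin r (r / M)).
  assert (0 < r / M) by (apply Rdiv_lt_0_compat; auto).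
  split; [apply Rmin_pos; auto|]. intros s y Hs Hy.
  assert (H1 := Rmin_l r (r / M)). assert (H2 := Rmin_r r (r / M)).
  assert (s - t < r / M) by lra. assert (Hlt : (s - t) * M < r) by (apply Rlt_div_r; auto).
  apply H; [apply Rabs_def1; lra | lra].
Qed.

(** Subsolutions share the value at [a] and the Lipschitz constant, so their pointwise supremum is
    finite and Lipschitz. The Dini bound passes to it because all of them can be compared with one
    and the same line on one and the same interval. *)
Lemma subsolution_sup (g : R -> R -> R) (M a x0 : R) :
  (forall t x, continuity_2d_pt g t x) -> (forall t x, Rabs (g t x) <= M) -> 0 < M ->
  exists phi, subsolution g M a x0 phi /\
    forall u t, subsolution g M a x0 u -> u t <= phi t.
Proof.
  intros Hg HM M0.
  set (S := subsolution g M a x0).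
  set (V := fun t y => exists u, S u /\ y = u t).
  assert (Hlub : forall t, exists m, is_lub (V t) m).
  { intros t. destruct (completeness (V t)) as [m Hm]; [| |exists m; auto].
    - exists (x0 + M * Rabs (t - a)). intros y [u [[Ha [Hl _]] ->]].
      rewrite <- Ha. apply lipschitz_upper; auto.
    (* The line of slope [- M] is a subsolution since [g >= - M], so the family is not empty. *)
    - exists (x0 + (- M) * (t - a)), (fun t => x0 + (- M) * (t - a)). split; auto.
      split; [|split].
      + ring.
      + apply lipschitz_affine. rewrite Rabs_Ropp, Rabs_pos_eq; lra.
      + intros s eps _ He. exists 1; split; [lra|]. intros r Hr.
        specialize (HM s (x0 + - M * (s - a))). apply Rabs_le_between in HM. nra. }
  set (phi := fun t => proj1_sig (constructive_indefinite_description _ (Hlub t))).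
  assert (Hphi : forall t, is_lub (V t) (phi t)).
  { intros t. unfold phi. apply proj2_sig. }
  clearbody phi.
  assert (Hge : forall u t, S u -> u t <= phi t).
  { intros u t Hu. apply (Hphi t). exists u; auto. }
  assert (Hle : forall t m, (forall u, S u -> u t <= m) -> phi t <= m).
  { intros t m H. apply (Hphi t). intros y [u [Hu ->]]. auto. }
  assert (Hlip : lipschitz M phi).
  { apply upper_lipschitz. intros s t. apply Hle. intros u Hu.
    apply Rle_trans with (u t + M * Rabs (s - t)).
    - apply lipschitz_upper, Hu.
    - apply Rplus_le_compat_r, Hge, Hu. }
  exists phi; split; [|auto]. split; [|split; auto].
  - apply Rle_antisym.
    + apply Hle. intros u [Hu _]. lra.
    (* If [phi a < x0], no subsolution exists, so [phi a - 1] is vacuously an upper bound below the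
       least one. *)
    + destruct (Rle_lt_dec x0 (phi a)) as [|Hlt]; auto. exfalso.
      assert (phi a <= phi a - 1); [|lra].
      apply (Hphi a). intros y Hy.
      destruct Hy as [u [Hu ->]]. pose proof (Hge u a Hu). destruct Hu as [Hu _]. lra.
  - intros t0 eps Ht0 He.
    set (K := g t0 (phi t0) + eps).
    (* Since [M + eps] bounds [Rabs K], the line of slope [K] stays in the cone. The length [h] is
       chosen before [u], so the resulting bound survives the supremum. *)
    destruct (bounded_near g t0 (phi t0) (eps / 2) (M + eps) (Hg _ _)) as [h [Hh Hbox]]; try lra.
    exists h; split; auto. intros s Hs. apply Hle. intros u Hu.
    apply (barrier u (phi t0) K t0 s); [lra | | apply Hge; auto |].
    + intros t _. apply (lipschitz_continuous M); [auto | apply Hu].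
    + intros t Ht Heq. destruct Hu as [_ [_ Hu]].
      destruct (Hu t (eps / 2)) as [d [Hd H]]; [lra|lra|].
      exists d; split; auto. intros r Hr. specialize (H r Hr).
      assert (Hb : Rabs (g t (u t) - g t0 (phi t0)) < eps / 2).
      { apply Hbox; [lra|]. rewrite Heq.
        replace (phi t0 + K * (t - t0) - phi t0) with (K * (t - t0)) by ring.
        rewrite Rabs_mult, (Rabs_pos_eq (t - t0)) by lra.
        apply Rmult_le_compat_r; [lra|]. unfold K.
        specialize (HM t0 (phi t0)). apply Rabs_le_between in HM. apply Rabs_le; lra. }
      apply Rabs_def2 in Hb. unfold K. nra.
Qed.

(* If the maximal subsolution [phi] fell below a line of slope [k < g] right of [t0],
   it could be replaced by its maximum with a trapezoid of slopes [M], [k], [-M]. *)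
Lemma max_subsolution_lower (g : R -> R -> R) (M a x0 : R) (phi : R -> R) (t0 eps : R) :
  (forall t x, continuity_2d_pt g t x) -> (forall t x, Rabs (g t x) <= M) -> 0 < M ->
  subsolution g M a x0 phi -> (forall u t, subsolution g M a x0 u -> u t <= phi t) ->
  a <= t0 -> 0 < eps ->
  exists d, 0 < d /\ forall s, t0 < s < t0 + d ->
    phi t0 + (g t0 (phi t0) - eps) * (s - t0) <= phi s.
Proof.
  intros Hg HM M0 Hphi Hmax Ht0 He.
  destruct Hphi as [Ha [Hl Hsub]].
  set (y0 := phi t0). set (k := g t0 y0 - eps).
  assert (Hg0 := HM t0 y0). apply Rabs_le_between in Hg0.
  (* For [k <= - M] the Lipschitz bound on [phi] is enough; otherwise [- M < k <= M] puts the three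
     sides of the trapezoid in the right order. *)
  destruct (Rle_lt_dec k (- M)) as [HkM|HkM].
  { exists 1; split; [lra|]. intros s Hs.
    assert (H := lipschitz_upper M phi t0 s Hl).
    rewrite Rabs_minus_sym, Rabs_pos_eq in H by lra. fold y0 in H.
    assert (k * (s - t0) <= - M * (s - t0)) by (apply Rmult_le_compat_r; lra). lra. }
  assert (Hk : - M < k <= M) by (split; [auto | unfold k; lra]).
  destruct (bounded_near g t0 y0 eps M (Hg _ _) He M0) as [h [Hh Hbox]].
  exists h; split; auto. intros t1 Ht1.
  set (w := fun t => Rmin (Rmin (y0 + M * (t - t0)) (y0 + k * (t - t0)))
                          (y0 + k * (t1 - t0) + - M * (t - t1))).
  assert (Hwl : lipschitz M w).
  { unfold w. apply lipschitz_min; [apply lipschitz_min|]; apply lipschitz_affine;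
      apply Rabs_le; lra. }
  assert (w1 : forall t, w t <= y0 + M * (t - t0)).
  { intros t. unfold w. eapply Rle_trans; [apply Rmin_l | apply Rmin_l]. }
  assert (w2 : forall t, w t <= y0 + k * (t - t0)).
  { intros t. unfold w. eapply Rle_trans; [apply Rmin_l | apply Rmin_r]. }
  assert (wmid : forall t, t0 <= t <= t1 -> w t = y0 + k * (t - t0)).
  { intros t Ht. unfold w.
    rewrite (Rmin_right (y0 + M * (t - t0))) by nra. apply Rmin_left. nra. }
  assert (wend : forall t, t1 <= t -> w t = y0 + k * (t1 - t0) + - M * (t - t1)).
  { intros t Ht. unfold w.
    rewrite (Rmin_right (y0 + M * (t - t0))) by nra. apply Rmin_right. nra. }
  assert (wphi : forall t, t <= t0 -> w t <= phi t).
  { intros t Ht. apply Rle_trans with (1 := w1 t).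
    assert (H := lipschitz_upper M phi t0 t Hl). rewrite Rabs_pos_eq in H by lra.
    unfold y0. lra. }
  assert (Hu : subsolution g M a x0 (fun t => Rmax (phi t) (w t))).
  { split; [|split].
    - rewrite Rmax_left; auto.
    - apply lipschitz_max; auto.
    - intros t e Ht Hepos.
      destruct (Rlt_le_dec t t0) as [Hlt|Hle].
      { destruct (Hsub t e Ht Hepos) as [d [Hd H]].
        exists (Rmin d (t0 - t)); split; [apply Rmin_pos; lra|]. intros s Hs.
        assert (H1 := Rmin_l d (t0 - t)). assert (H2 := Rmin_r d (t0 - t)).
        rewrite (Rmax_left (phi t)), (Rmax_left (phi s)) by (apply wphi; lra).
        apply H; lra. }
      set (ut := Rmax (phi t) (w t)).
      assert (Hgt := HM t ut). apply Rabs_le_between in Hgt.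
      (* the branch that is strictly below the maximum stays below by continuity *)
      assert (Hlow : forall v, lipschitz M v -> v t < ut ->
        exists d, 0 < d /\ forall s, t < s < t + d -> v s <= ut + (g t ut + e) * (s - t)).
      { intros v Hv Hvt. exists ((ut - v t) / (2 * M)).
        split; [apply Rdiv_lt_0_compat; lra|]. intros s Hs.
        assert (Hq : s - t < (ut - v t) / (2 * M)) by lra.
        apply Rlt_div_r in Hq; [|lra].
        assert (H := lipschitz_upper M v s t Hv). rewrite Rabs_pos_eq in H by lra.
        assert (- M * (s - t) <= (g t ut + e) * (s - t)) by (apply Rmult_le_compat_r; lra).
        lra. }
      assert (Hp : exists d, 0 < d /\ forall s, t < s < t + d ->
                 phi s <= ut + (g t ut + e) * (s - t)).
      { destruct (Rle_lt_or_eq_dec (phi t) ut (Rmax_l _ _)) as [Hlt|Heq]; [auto|].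
        rewrite <- Heq. apply Hsub; auto. }
      assert (Hw : exists d, 0 < d /\ forall s, t < s < t + d ->
                 w s <= ut + (g t ut + e) * (s - t)).
      { destruct (Rle_lt_or_eq_dec (w t) ut (Rmax_r _ _)) as [Hlt|Heq]; [auto|].
        exists 1; split; [lra|]. intros s Hs.
        (* Where [w] attains the maximum, its slope is [k], below [g] in the cone, before [t1], and
           [- M], a lower bound of [g], from [t1] on. An increment reaching past [t1] is still
           bounded by the line of slope [k]. *)
        destruct (Rlt_le_dec t t1) as [Htt|Htt].
        - assert (Hb : Rabs (g t ut - g t0 y0) < eps).
          { apply Hbox; [lra|]. rewrite <- Heq, wmid by lra.
            replace (y0 + k * (t - t0) - y0) with (k * (t - t0)) by ring.
            rewrite Rabs_mult, (Rabs_pos_eq (t - t0)) by lra.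
            apply Rmult_le_compat_r; [lra|]. apply Rabs_le; lra. }
          apply Rabs_def2 in Hb. apply Rle_trans with (1 := w2 s).
          rewrite <- Heq at 1. rewrite wmid by lra.
          assert (k * (s - t) <= (g t ut + e) * (s - t)); [|lra].
          apply Rmult_le_compat_r; unfold k; lra.
        - rewrite <- Heq at 1. rewrite !wend by lra.
          assert (- M * (s - t) <= (g t ut + e) * (s - t)) by (apply Rmult_le_compat_r; lra).
          lra. }
      destruct Hp as [d1 [Hd1 H1]]. destruct Hw as [d2 [Hd2 H2]].
      exists (Rmin d1 d2); split; [apply Rmin_pos; lra|]. intros s Hs.
      assert (Hm1 := Rmin_l d1 d2). assert (Hm2 := Rmin_r d1 d2).
      apply Rmax_lub; [apply H1 | apply H2]; lra. }
  (* Maximality is used at the corner [t1], where [w] still lies on the line of slope [k]. *)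
  specialize (Hmax _ t1 Hu). cbv beta in Hmax.
  assert (Hr := Rmax_r (phi t1) (w t1)). rewrite <- (wmid t1) by lra.
  exact (Rle_trans _ _ _ Hr Hmax).
Qed.

(** The upper and lower bounds show that the maximal subsolution has right derivative [g t (phi t)]
    from [a] on. As this is continuous in time, the derivative is in fact two-sided. *)
Lemma peano_bounded (g : R -> R -> R) (M a x0 : R) :
  (forall t x, continuity_2d_pt g t x) -> (forall t x, Rabs (g t x) <= M) -> 0 < M ->
  exists u, u a = x0 /\ forall t, a <= t -> is_derive u t (g t (u t)).
Proof.
  intros Hg HM M0.
  destruct (subsolution_sup g M a x0 Hg HM M0) as [phi [Hphi Hmax]].
  set (c := g a x0).
  assert (Hphi' := Hphi). destruct Hphi' as [Ha [Hl Hsub]].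
  (* Before [a], [phi] is replaced by its tangent line of slope [c], which makes the derivative at
     [a] two-sided. The right derivative of [u] is then continuous on all of R. *)
  set (u := fun t => phi (Rmax a t) + c * (Rmin a t - a)).
  assert (Hur : forall t, a <= t -> u t = phi t).
  { intros t Ht. unfold u. rewrite Rmax_right, Rmin_left by auto. ring. }
  assert (Hul : forall t, t <= a -> u t = x0 + c * (t - a)).
  { intros t Ht. unfold u. rewrite Rmax_left, Rmin_right, Ha by auto. ring. }
  assert (Hc := HM a x0). fold c in Hc.
  assert (Hlu : lipschitz M u).
  { apply upper_lipschitz. intros s t.
    assert (Hp := lipschitz_upper M phi).
    assert (Hq := lipschitz_upper M (fun t => x0 + c * (t - a))).
    destruct (Rle_lt_dec a s) as [Hs|Hs]; destruct (Rle_lt_dec a t) as [Ht|Ht].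
    - rewrite !Hur by lra. auto.
    - rewrite (Hur s), (Hul t) by lra. apply Rle_trans with (phi a + M * (s - a)).
      + rewrite <- (Rabs_pos_eq (s - a)) by lra. auto.
      + rewrite (Rabs_pos_eq (s - t)) by lra. apply Rabs_le_between in Hc. rewrite Ha. nra.
    - rewrite (Hul s), (Hur t) by lra. apply Rle_trans with (phi a + M * (a - s)).
      + apply Rabs_le_between in Hc. rewrite Ha. nra.
      + assert (H := Hp a t Hl).
        rewrite (Rabs_minus_sym s t), (Rabs_pos_eq (t - s)) by lra.
        rewrite (Rabs_minus_sym a t), (Rabs_pos_eq (t - a)) in H by lra. lra.
    - rewrite !Hul by lra. apply Hq. apply lipschitz_affine; auto. }
  exists u. split; [rewrite Hur; lra|].
  set (G := fun t => g (Rmax a t) (phi (Rmax a t))).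
  intros t0 Ht0.
  replace (g t0 (u t0)) with (G t0) by (unfold G; rewrite Rmax_right, Hur; auto).
  apply (right_derivative_is_derive M); auto.
  - apply filterlim_locally. intros eps.
    destruct (Hg (Rmax a t0) (phi (Rmax a t0)) eps) as [r Hr].
    assert (Hmx : forall s, Rabs (Rmax a s - Rmax a t0) <= Rabs (s - t0)).
    { intros s. unfold Rmax.
      destruct (Rle_dec a s), (Rle_dec a t0); unfold Rabs;
        repeat destruct Rcase_abs; lra. }
    assert (Hr0 := cond_pos r).
    assert (Hd : 0 < Rmin r (r / M)) by (apply Rmin_pos; [|apply Rdiv_lt_0_compat]; auto).
    exists (mkposreal _ Hd). intros s Hs.
    change (Rabs (s - t0) < Rmin r (r / M)) in Hs.
    change (Rabs (G s - G t0) < eps).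
    assert (H1 := Rmin_l r (r / M)). assert (H2 := Rmin_r r (r / M)).
    specialize (Hmx s). apply Hr; [lra|].
    apply Rle_lt_trans with (1 := Hl _ _).
    assert (H3 : Rabs (s - t0) < r / M) by lra. apply Rlt_div_r in H3; auto. nra.
  - intros t eps He. destruct (Rle_lt_dec a t) as [Ht|Ht].
    + destruct (Hsub t eps Ht He) as [d1 [Hd1 H1]].
      destruct (max_subsolution_lower g M a x0 phi t eps Hg HM M0 Hphi Hmax Ht He)
        as [d2 [Hd2 H2]].
      exists (Rmin d1 d2); split; [apply Rmin_pos; auto|]. intros s Hs.
      assert (Hm1 := Rmin_l d1 d2). assert (Hm2 := Rmin_r d1 d2).
      specialize (H1 s ltac:(lra)). specialize (H2 s ltac:(lra)).
      unfold G. rewrite Rmax_right, !Hur by lra. apply Rabs_le. lra.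
    + exists (a - t); split; [lra|]. intros s Hs. unfold G.
      rewrite Rmax_left, Ha, !Hul by lra. fold c.
      replace (_ - _ - _) with 0 by ring. rewrite Rabs_R0. nra.
Qed.

(** * Comparison, uniqueness and monotonicity *)

(** The derivative is two-sided even at [tau], so the values of [u] just to the left of [tau]
    matter. *)
Definition solves (g : R -> R -> R) (tau xi b : R) (u : R -> R) : Prop :=
  u tau = xi /\ forall t, tau <= t < b -> is_derive u t (g t (u t)).

(** The bound [b] admits clamped fields, which are constant in time beyond the clamping
    rectangle. *)
Definition increasing_in_time (g : R -> R -> R) (tau b : R) : Prop :=
  forall x s t, tau <= s < t -> t < b -> g s x < g t x.

Lemma solves_continuous (g : R -> R -> R) (tau xi b t : R) (u : R -> R) :
  solves g tau xi b u -> tau <= t < b -> continuous u t.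
Proof.
  intros [_ H] Ht. apply (ex_derive_continuous u). exists (g t (u t)); auto.
Qed.

(* At a contact point of [v] with the shifted solution [u (. + d)] the latter has the
   larger derivative, since [g] is increasing in time; hence [v] cannot cross it. *)
Lemma solves_shift (g : R -> R -> R) (tau xi b : R) (u v : R -> R) :
  increasing_in_time g tau b -> 0 < g tau xi -> tau < b ->
  solves g tau xi b u -> solves g tau xi b v ->
  exists d0, 0 < d0 /\ forall d s, 0 < d < d0 -> tau <= s -> s + d < b -> v s <= u (s + d).
Proof.
  intros Hg H0 Hb Hu Hv.
  destruct (is_derive_pos_right u tau (g tau xi)) as [d0 [Hd0 H]]; auto.
  { destruct Hu as [<- Hu]. apply Hu; lra. }
  exists d0; split; auto. intros d s Hd Hs Hsb.
  assert (Hder : forall t, tau <= t -> t + d < b ->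
    is_derive (fun r => u (r + d) - v r) t (g (t + d) (u (t + d)) - g t (v t))).
  { intros t Ht Htb.
    apply (is_derive_minus (fun r => u (r + d)) v).
    - replace (g (t + d) (u (t + d))) with (scal 1 (g (t + d) (u (t + d))))
        by apply (Rmult_1_l).
      apply (is_derive_comp u (fun r => r + d)).
      + apply Hu; lra.
      + auto_derive; auto.
    - apply Hv; lra. }
  (* The barrier is the zero line, for the difference of [v] and the shifted solution. *)
  cut (v s - u (s + d) <= 0 + 0 * (s - tau)); [lra|].
  apply (barrier (fun r => v r - u (r + d))); auto.
  - intros t Ht.
    apply (continuous_ext (fun r => - (u (r + d) - v r))); [intros; simpl; ring|].
    apply (continuous_opp (fun r => u (r + d) - v r)).
    apply (ex_derive_continuous (fun r => u (r + d) - v r)).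
    eexists. apply Hder; lra.
  - destruct Hu as [Hu1 _]. destruct Hv as [Hv1 _].
    specialize (H (tau + d) ltac:(lra)). lra.
  - intros t Ht Heq.
    assert (Hc : v t = u (t + d)) by lra.
    destruct (is_derive_pos_right _ t _ (Hder t ltac:(lra) ltac:(lra))) as [e [He He']].
    { rewrite Hc. apply Rlt_0_minus. apply Hg; lra. }
    exists e; split; auto. intros r Hr. specialize (He' r Hr). cbv beta in He'. lra.
Qed.

(** If [u t < v t], continuity gives [u (t + d) < v t] for small [d], against the shift
    comparison. *)
Lemma solves_le (g : R -> R -> R) (tau xi b t : R) (u v : R -> R) :
  increasing_in_time g tau b -> 0 < g tau xi ->
  solves g tau xi b u -> solves g tau xi b v -> tau <= t < b -> v t <= u t.
Proof.
  intros Hg H0 Hu Hv Ht.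
  destruct (solves_shift g tau xi b u v) as [d0 [Hd0 H]]; auto; [lra|].
  destruct (Rle_lt_dec (v t) (u t)) as [|Hlt]; auto. exfalso.
  destruct (continuous_eps u t (v t - u t)) as [e [He He']]; [|lra|].
  { eapply solves_continuous; eauto. }
  set (d := Rmin (d0 / 2) (Rmin (e / 2) ((b - t) / 2))).
  assert (Hd : 0 < d) by (repeat apply Rmin_pos; lra).
  assert (H1 : d <= d0 / 2) by apply Rmin_l.
  assert (H2 : d <= Rmin (e / 2) ((b - t) / 2)) by apply Rmin_r.
  assert (H3 := Rmin_l (e / 2) ((b - t) / 2)). assert (H4 := Rmin_r (e / 2) ((b - t) / 2)).
  specialize (H d t ltac:(lra) ltac:(lra) ltac:(lra)).
  specialize (He' (t + d)). replace (t + d - t) with d in He' by ring.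
  rewrite (Rabs_pos_eq d) in He' by lra. specialize (He' ltac:(lra)).
  apply Rabs_def2 in He'. lra.
Qed.

Lemma solves_unique (g : R -> R -> R) (tau xi b t : R) (u v : R -> R) :
  increasing_in_time g tau b -> 0 < g tau xi ->
  solves g tau xi b u -> solves g tau xi b v -> tau <= t < b -> v t = u t.
Proof.
  intros Hg H0 Hu Hv Ht. apply Rle_antisym; eapply solves_le; eauto.
Qed.

(** Comparing [u] with its own shift gives [u t <= u (t + d)] for all small [d], which a negative
    derivative at [t] would contradict. *)
Lemma solves_field_nonneg (g : R -> R -> R) (tau xi b t : R) (u : R -> R) :
  increasing_in_time g tau b -> 0 < g tau xi ->
  solves g tau xi b u -> tau <= t < b -> 0 <= g t (u t).
Proof.
  intros Hg H0 Hu Ht.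
  destruct (solves_shift g tau xi b u u) as [d0 [Hd0 H]]; auto; [lra|].
  destruct (Rle_lt_dec 0 (g t (u t))) as [|Hlt]; auto. exfalso.
  destruct (is_derive_pos_right (fun s => - u s) t (- g t (u t))) as [e [He He']]; [|lra|].
  { apply (is_derive_opp u). apply Hu; auto. }
  set (d := Rmin (d0 / 2) (Rmin (e / 2) ((b - t) / 2))).
  assert (Hd : 0 < d) by (repeat apply Rmin_pos; lra).
  assert (H1 : d <= d0 / 2) by apply Rmin_l.
  assert (H2 : d <= Rmin (e / 2) ((b - t) / 2)) by apply Rmin_r.
  assert (H3 := Rmin_l (e / 2) ((b - t) / 2)). assert (H4 := Rmin_r (e / 2) ((b - t) / 2)).
  specialize (H d t ltac:(lra) ltac:(lra) ltac:(lra)).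
  specialize (He' (t + d) ltac:(lra)). lra.
Qed.

Lemma solves_MVT (g : R -> R -> R) (tau xi b s t : R) (u : R -> R) :
  solves g tau xi b u -> tau <= s < t -> t < b ->
  exists c, s <= c <= t /\ u t - u s = g c (u c) * (t - s).
Proof.
  intros Hu Hs Ht.
  destruct (MVT_gen u s t (fun c => g c (u c))) as [c [Hc Heq]].
  - intros x Hx. rewrite Rmin_left, Rmax_right in Hx by lra. apply Hu; lra.
  - intros x Hx. rewrite Rmin_left, Rmax_right in Hx by lra.
    apply continuity_pt_filterlim. apply (solves_continuous g tau xi b x u Hu); lra.
  - rewrite Rmin_left, Rmax_right in Hc by lra. exists c; auto.
Qed.

Lemma solves_strict_increasing (g : R -> R -> R) (tau xi b s t : R) (u : R -> R) :
  increasing_in_time g tau b -> 0 < g tau xi ->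
  solves g tau xi b u -> tau <= s < t -> t < b -> u s < u t.
Proof.
  intros Hg H0 Hu Hs Ht.
  assert (Hinc : forall p q, tau <= p <= q -> q < b -> u p <= u q).
  { intros p q Hp Hq. destruct (Req_dec p q) as [->|Hne]; [lra|].
    destruct (solves_MVT g tau xi b p q u Hu) as [c [Hc Heq]]; [lra|lra|].
    assert (Hn := solves_field_nonneg g tau xi b c u Hg H0 Hu ltac:(lra)). nra. }
  destruct (Rle_lt_or_eq_dec (u s) (u t)) as [|Heq]; [apply Hinc; lra | auto |].
  exfalso.
  (* If [u s = u t], then [u] is constant on [[s, t]], and the mean value theorem puts a zero of [g]
     at the level [u s] in each subinterval. The first and last thirds are disjoint, hence give two
     distinct zeros. *)
  assert (Hzero : forall p q, s <= p < q -> q <= t ->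
            exists c, p <= c <= q /\ g c (u s) = 0).
  { intros p q Hp Hq. destruct (solves_MVT g tau xi b p q u Hu) as [c [Hc Hm]]; [lra|lra|].
    exists c; split; auto.
    assert (H1 := Hinc s p ltac:(lra) ltac:(lra)). assert (H2 := Hinc q t ltac:(lra) ltac:(lra)).
    assert (H3 := Hinc p q ltac:(lra) ltac:(lra)).
    assert (H4 := Hinc s c ltac:(lra) ltac:(lra)). assert (H5 := Hinc c t ltac:(lra) ltac:(lra)).
    replace (u c) with (u s) in Hm by lra.
    assert (Hz : g c (u s) * (q - p) = 0) by lra.
    apply Rmult_integral in Hz. lra. }
  destruct (Hzero s (s + (t - s) / 3)) as [c1 [Hc1 Hz1]]; [lra|lra|].
  destruct (Hzero (s + 2 * ((t - s) / 3)) t) as [c2 [Hc2 Hz2]]; [lra|lra|].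
  assert (H := Hg (u s) c1 c2 ltac:(lra) ltac:(lra)). lra.
Qed.

(** * Continuation of bounded solutions *)

Definition clamp (lo hi x : R) : R := Rmax lo (Rmin hi x).

Lemma clamp_id (lo hi x : R) : lo <= x <= hi -> clamp lo hi x = x.
Proof. intros H. unfold clamp. rewrite Rmin_right, Rmax_right; lra. Qed.

Lemma clamp_between (lo hi x : R) : lo <= hi -> lo <= clamp lo hi x <= hi.
Proof.
  intros H. unfold clamp. split; [apply Rmax_l|]. apply Rmax_lub; [auto | apply Rmin_l].
Qed.

Lemma clamp_lipschitz (lo hi x y : R) :
  lo <= hi -> Rabs (clamp lo hi x - clamp lo hi y) <= Rabs (x - y).
Proof.
  intros H. unfold clamp, Rmax, Rmin.
  destruct (Rle_dec hi x), (Rle_dec hi y); repeat destruct Rle_dec;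
    unfold Rabs; repeat destruct Rcase_abs; lra.
Qed.

Lemma class_F_continuity_2d (f : R -> R -> R) :
  class_F f -> forall t x, continuity_2d_pt f t x.
Proof. intros [Hc _] t x. apply continuity_2d_pt_filterlim. apply (Hc (t, x)). Qed.

Lemma continuous_along (f : R -> R -> R) (u : R -> R) (t : R) :
  class_F f -> continuous u t -> continuous (fun s => f s (u s)) t.
Proof.
  intros [Hc _] Hu. apply (continuous_comp_2 (fun s => s) u f).
  - apply continuous_id.
  - auto.
  - apply (Hc (t, u t)).
Qed.

(** Peano's theorem applies to the clamped field: by monotonicity in time its values lie between
    those of [f tau] and [f B], which are bounded on [[lo, hi]]. *)
Lemma truncated_solution (f : R -> R -> R) (tau xi B lo hi : R) :
  class_F f -> tau < B -> lo <= hi ->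
  exists psi, psi tau = xi /\
    forall t, tau <= t -> is_derive psi t (f (clamp tau B t) (clamp lo hi (psi t))).
Proof.
  intros Hf HB Hlh.
  assert (Hc : forall t x, continuous (f t) x).
  { intros t x. destruct Hf as [Hf _].
    apply (continuous_comp_2 (fun _ => t) (fun s => s) f).
    - apply continuous_const.
    - apply continuous_id.
    - apply (Hf (t, x)). }
  assert (Hb : forall t, exists m, forall x, lo <= x <= hi -> Rabs (f t x) <= m).
  { intros t. destruct (continuity_ab_maj (fun x => Rabs (f t x)) lo hi Hlh) as [m [Hm _]].
    - intros x _. apply continuity_pt_filterlim. apply (continuous_comp (f t) Rabs).
      + apply Hc.
      + apply continuous_Rabs.
    - exists (Rabs (f t m)). auto. }
  destruct (Hb tau) as [m1 Hm1]. destruct (Hb B) as [m2 Hm2].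
  apply (peano_bounded (fun t x => f (clamp tau B t) (clamp lo hi x)) (m1 + m2 + 1)).
  - intros t x eps.
    destruct (class_F_continuity_2d f Hf (clamp tau B t) (clamp lo hi x) eps) as [d Hd].
    exists d. intros s y Hs Hy. apply Hd.
    + eapply Rle_lt_trans; [apply clamp_lipschitz; lra | auto].
    + eapply Rle_lt_trans; [apply clamp_lipschitz; lra | auto].
  - intros t x.
    assert (Ht := clamp_between tau B t ltac:(lra)).
    assert (Hx := clamp_between lo hi x Hlh).
    set (t' := clamp tau B t) in *. set (x' := clamp lo hi x) in *.
    specialize (Hm1 x' Hx). specialize (Hm2 x' Hx).
    destruct Hf as [_ [Hinc _]].
    assert (H1 : f tau x' <= f t' x').
    { destruct (Req_dec tau t') as [<-|]; [lra|]. left; apply (Hinc x'); lra. }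
    assert (H2 : f t' x' <= f B x').
    { destruct (Req_dec t' B) as [->|]; [lra|]. left; apply (Hinc x'); lra. }
    assert (H3 := Rabs_pos (f tau x')). assert (H4 := Rabs_pos (f B x')).
    apply Rabs_le_between in Hm1. apply Rabs_le_between in Hm2.
    apply Rabs_le. lra.
  - assert (H1 := Hm1 lo ltac:(lra)). assert (H2 := Hm2 lo ltac:(lra)).
    assert (H3 := Rabs_pos (f tau lo)). assert (H4 := Rabs_pos (f B lo)). lra.
Qed.

(** By continuity [psi] stays in the window slightly beyond [c], and there the clamps are the
    identity. *)
Lemma truncated_solves (f : R -> R -> R) (tau xi B lo hi c : R) (psi : R -> R) :
  psi tau = xi ->
  (forall t, tau <= t -> is_derive psi t (f (clamp tau B t) (clamp lo hi (psi t)))) ->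
  tau <= c < B -> (forall t, tau <= t <= c -> lo < psi t < hi) ->
  exists b, c < b /\ solves f tau xi b psi.
Proof.
  intros H0 Hd Hc Hin.
  assert (Hcont : continuous psi c).
  { apply (ex_derive_continuous psi). eexists. apply Hd; lra. }
  assert (Hpc := Hin c ltac:(lra)).
  destruct (continuous_eps psi c (Rmin (psi c - lo) (hi - psi c)) Hcont) as [d [Hd0 Hd1]].
  { apply Rmin_pos; lra. }
  exists (Rmin (c + d) B). split; [apply Rmin_glb_lt; lra|]. split; auto.
  intros t Ht.
  assert (H1 := Rmin_l (c + d) B). assert (H2 := Rmin_r (c + d) B).
  assert (lo <= psi t <= hi).
  { destruct (Rle_lt_dec t c) as [Htc|Htc]; [specialize (Hin t); lra|].
    assert (H := Hd1 t ltac:(apply Rabs_def1; lra)).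
    assert (H3 := Rmin_l (psi c - lo) (hi - psi c)).
    assert (H4 := Rmin_r (psi c - lo) (hi - psi c)).
    apply Rabs_def2 in H. lra. }
  specialize (Hd t ltac:(lra)). rewrite !clamp_id in Hd by lra. exact Hd.
Qed.

Lemma solves_extend (f : R -> R -> R) (tau xi c X : R) :
  class_F f -> 0 < f tau xi -> tau < c ->
  (forall b, tau < b < c -> exists u, solves f tau xi b u /\
     forall t, tau <= t < b -> u t <= X) ->
  exists b u, c < b /\ solves f tau xi b u.
Proof.
  intros Hf H0 Hc Hex.
  assert (HX : xi <= X).
  { destruct (Hex ((tau + c) / 2)) as [u [[Hu _] Hle]]; [lra|].
    rewrite <- Hu. apply Hle; lra. }
  (* The margins of 1 leave room beyond time [c] and around the values in [[xi, X]]. *)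
  destruct (truncated_solution f tau xi (c + 1) (xi - 1) (X + 1) Hf) as [psi [Hp0 Hp]];
    [lra|lra|].
  assert (Hf' := Hf). destruct Hf' as [_ [Hinc _]].
  assert (Hbefore : forall t, tau <= t < c -> xi <= psi t <= X).
  { intros t Ht. destruct (Hex ((t + c) / 2)) as [u [Hu Hle]]; [lra|].
    assert (Hbd : forall s, tau <= s < (t + c) / 2 -> xi <= u s <= X).
    { intros s Hs. split; [|auto]. destruct (Req_dec tau s) as [<-|Hne].
      - destruct Hu as [Hu _]. lra.
      - left. rewrite <- (proj1 Hu) at 1.
        apply (solves_strict_increasing f tau xi ((t + c) / 2)); auto; try lra.
        intros x r1 r2 Hr _. apply (Hinc x); lra. }
    (* Uniqueness is applied to the clamped field: [u] solves it because its values lie in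
       [[xi, X]], and [psi] by construction. *)
    rewrite (solves_unique (fun t x => f (clamp tau (c + 1) t) (clamp (xi - 1) (X + 1) x))
               tau xi ((t + c) / 2) t u psi).
    - apply Hbd; lra.
    - intros x r1 r2 Hr Hrb. rewrite (clamp_id tau (c + 1) r1), (clamp_id tau (c + 1) r2) by lra.
      apply Hinc; lra.
    - rewrite !clamp_id by lra. auto.
    - split; [apply Hu|]. intros s Hs. specialize (Hbd s Hs).
      rewrite !clamp_id by lra. apply Hu; auto.
    - split; auto. intros s Hs. apply Hp; lra.
    - lra. }
  destruct (truncated_solves f tau xi (c + 1) (xi - 1) (X + 1) c psi) as [b [Hb Hs]]; auto.
  - lra.
  - intros t Ht. destruct (Rle_lt_or_eq_dec t c (proj2 Ht)) as [Hlt| ->].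
    + specialize (Hbefore t). lra.
    (* At [c] itself [psi] is within 1 of a value in [[xi, X]], hence strictly inside the window. *)
    + assert (Hcont : continuous psi c).
      { apply (ex_derive_continuous psi). eexists. apply Hp; lra. }
      destruct (continuous_eps psi c 1 Hcont) as [d [Hd0 Hd]]; [lra|].
      set (r := Rmax tau (c - d / 2)).
      assert (tau <= r) by apply Rmax_l. assert (c - d / 2 <= r) by apply Rmax_r.
      assert (r < c) by (apply Rmax_lub_lt; lra).
      specialize (Hbefore r ltac:(lra)).
      specialize (Hd r ltac:(apply Rabs_def1; lra)). apply Rabs_def2 in Hd. lra.
  - exists b, psi; auto.
Qed.

Lemma solves_local (f : R -> R -> R) (tau xi : R) :
  class_F f -> exists b u, tau < b /\ solves f tau xi b u.
Proof.
  intros Hf.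
  destruct (truncated_solution f tau xi (tau + 1) (xi - 1) (xi + 1) Hf) as [psi [Hp0 Hp]];
    [lra|lra|].
  destruct (truncated_solves f tau xi (tau + 1) (xi - 1) (xi + 1) tau psi) as [b [Hb Hs]];
    auto; [lra| |exists b, psi; auto].
  intros t Ht. replace t with tau by lra. lra.
Qed.

(** * Derivatives relative to a half-open interval versus two-sided derivatives *)

Lemma is_derive_D_in (phi dphi u : R -> R) (tau b t : R) (T : Rbar) :
  tau <= t < b -> (forall s, tau <= s < b -> phi s = u s) ->
  is_derive u t (dphi t) -> D_in phi dphi (Ico tau T) t.
Proof.
  intros Ht Heq Hd eps He. apply is_derive_Reals in Hd.
  destruct (Hd eps He) as [d Hd'].
  exists (Rmin d (b - t)). split; [apply Rmin_pos; [apply cond_pos | lra]|].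
  intros s [[[Hs _] Hne] Hdist]. simpl in *. unfold Rdist in *.
  assert (H1 := Rmin_l d (b - t)). assert (H2 := Rmin_r d (b - t)).
  assert (Hsb : s < b) by (apply Rabs_def2 in Hdist; lra).
  specialize (Hd' (s - t) ltac:(lra) ltac:(lra)).
  replace (t + (s - t)) with s in Hd' by ring.
  rewrite !Heq by lra. exact Hd'.
Qed.

Lemma continuous_continue_in (dphi h : R -> R) (tau b t : R) (T : Rbar) :
  tau <= t < b -> (forall s, tau <= s < b -> dphi s = h s) ->
  continuous h t -> continue_in dphi (Ico tau T) t.
Proof.
  intros Ht Heq Hc eps He.
  destruct (continuous_eps h t eps Hc He) as [d [Hd0 Hd]].
  exists (Rmin d (b - t)). split; [apply Rmin_pos; lra|].
  intros s [[[Hs _] Hne] Hdist]. simpl in *. unfold Rdist in *.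
  assert (H1 := Rmin_l d (b - t)). assert (H2 := Rmin_r d (b - t)).
  assert (Hsb : s < b) by (apply Rabs_def2 in Hdist; lra).
  rewrite !Heq by lra. apply Hd. lra.
Qed.

(* Extending by the tangent line to the left of [tau] makes the derivative two-sided. *)
Lemma D_in_solves (f : R -> R -> R) (tau xi b : R) (T : Rbar) (phi : R -> R) :
  Rbar_le b T -> phi tau = xi ->
  (forall t, Ico tau T t -> D_in phi (fun s => f s (phi s)) (Ico tau T) t) ->
  exists u, solves f tau xi b u /\ forall t, tau <= t -> u t = phi t.
Proof.
  intros HbT H0 Hd.
  set (u := fun t => if Rle_dec tau t then phi t else xi + f tau xi * (t - tau)).
  assert (Hr : forall t, tau <= t -> u t = phi t).
  { intros t Ht. unfold u. destruct (Rle_dec tau t); lra. }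
  assert (Hl : forall t, t < tau -> u t = xi + f tau xi * (t - tau)).
  { intros t Ht. unfold u. destruct (Rle_dec tau t); lra. }
  assert (HI : forall t, tau <= t < b -> Ico tau T t).
  { intros t Ht. split; [lra|]. apply Rbar_lt_le_trans with b; auto. simpl; lra. }
  exists u; split; auto. split; [rewrite Hr; lra|].
  intros t Ht. rewrite (Hr t) by lra. apply is_derive_Reals. intros eps He.
  destruct (Hd t (HI t Ht) eps He) as [a [Ha0 Ha]]. simpl in Ha. unfold Rdist in Ha.
  assert (Hright : forall s, tau <= s < b -> s <> t -> Rabs (s - t) < a ->
            Rabs ((u s - u t) / (s - t) - f t (phi t)) < eps).
  { intros s Hs Hne Hst. rewrite !Hr by lra. apply Ha. split; auto. split; auto. }
  destruct (Req_dec tau t) as [Heq|Hne].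
  - subst t. assert (Hp : 0 < Rmin a (b - tau)) by (apply Rmin_pos; lra).
    exists (mkposreal _ Hp). intros h Hh Hha. simpl in Hha.
    assert (H1 := Rmin_l a (b - tau)). assert (H2 := Rmin_r a (b - tau)).
    destruct (Rle_lt_dec 0 h) as [Hh0|Hh0].
    + rewrite Rabs_pos_eq in Hha by lra.
      assert (H := Hright (tau + h)). replace (tau + h - tau) with h in H by ring.
      apply H; [lra|lra|]. rewrite Rabs_pos_eq; lra.
    + rewrite (Hl (tau + h)), (Hr tau), H0 by lra.
      replace (_ / h - _) with 0 by (field; auto). rewrite Rabs_R0; auto.
  - assert (Hp : 0 < Rmin a (Rmin (t - tau) (b - t))) by (repeat apply Rmin_pos; lra).
    exists (mkposreal _ Hp). intros h Hh Hha. simpl in Hha.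
    assert (H1 := Rmin_l a (Rmin (t - tau) (b - t))).
    assert (H2 := Rmin_r a (Rmin (t - tau) (b - t))).
    assert (H3 := Rmin_l (t - tau) (b - t)). assert (H4 := Rmin_r (t - tau) (b - t)).
    assert (Hh' := Rabs_def2 _ _ Hha).
    assert (H := Hright (t + h)). replace (t + h - t) with h in H by ring.
    apply H; lra.
Qed.

(** * Order and suprema in the extended reals *)

Lemma Rbar_lt_exists_between (a : R) (T : Rbar) :
  Rbar_lt a T -> exists b : R, a < b /\ Rbar_lt b T.
Proof.
  destruct T as [t| |]; simpl; intros H.
  - exists ((a + t) / 2). lra.
  - exists (a + 1). split; [lra | auto].
  - contradiction.
Qed.

Lemma lt_Lub_Rbar (E : R -> Prop) (t : R) :
  Rbar_lt t (Lub_Rbar E) -> exists b, E b /\ t < b.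
Proof.
  intros Ht. apply NNPP. intros Hn.
  apply (Rbar_lt_not_le _ _ Ht). apply (proj2 (Lub_Rbar_correct E)).
  intros b Hb. simpl. destruct (Rle_lt_dec b t) as [|Hlt]; auto.
  exfalso. apply Hn. exists b; auto.
Qed.

Lemma le_Lub_Rbar (E : R -> Prop) (b : R) : E b -> Rbar_le b (Lub_Rbar E).
Proof. apply (proj1 (Lub_Rbar_correct E)). Qed.

Lemma Rbar_max_p_infty (a b : Rbar) :
  Rbar_max a b = p_infty <-> a = p_infty \/ b = p_infty.
Proof.
  unfold Rbar_max. destruct (Rbar_le_dec a b) as [H|H].
  - split; [auto|]. intros [->|Hb]; auto. destruct b; simpl in H; tauto.
  - split; [auto|]. intros [Ha| ->]; auto. exfalso. apply H. destruct a; simpl; auto.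
Qed.

(** * Gluing the solutions into the maximal one *)

Lemma solves_restrict (g : R -> R -> R) (tau xi b c : R) (u : R -> R) :
  c <= b -> solves g tau xi b u -> solves g tau xi c u.
Proof. intros Hc [H0 H]. split; auto. intros t Ht. apply H; lra. Qed.

Theorem mainTheorem1 (f : R -> R -> R) (tau xi : R)
  (Hf : class_F f) (Hpos : f tau xi > 0) :
  exists (T : Rbar) (phi : R -> R),
    maximal_solution f tau xi T phi /\
    (forall (T' : Rbar) (phi' : R -> R),
       maximal_solution f tau xi T' phi' ->
       T' = T /\ forall t, Ico tau T t -> phi' t = phi t) /\
    exists X : Rbar,
      Rbar_lt tau T /\ Rbar_lt xi X /\ Rbar_max T X = p_infty /\
      C1_path (Ico tau T) (Ico xi X) phi /\
      strict_increasing_on (Ico tau T) phi /\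
      bijective_on (Ico tau T) (Ico xi X) phi.
Proof.
  assert (Hinc : forall b, increasing_in_time f tau b).
  { intros b x s t Hs _. destruct Hf as [_ [H _]]. apply (H x); lra. }
  set (E := fun b => tau < b /\ exists u, solves f tau xi b u).
  set (T := Lub_Rbar E).
  assert (Hagree : forall b1 b2 u1 u2 t, solves f tau xi b1 u1 -> solves f tau xi b2 u2 ->
            tau <= t -> t < b1 -> t < b2 -> u1 t = u2 t).
  { intros b1 b2 u1 u2 t H1 H2 Ht Ht1 Ht2.
    apply (solves_unique f tau xi (Rmin b1 b2)); auto.
    - apply solves_restrict with b2; auto. apply Rmin_r.
    - apply solves_restrict with b1; auto. apply Rmin_l.
    - split; auto. apply Rmin_glb_lt; auto. }
  (* [phi t] is the value at [t] of some solution that lives beyond [t]; by [Hagree] the choice is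
     immaterial. At times that no solution reaches, [phi] is unspecified. *)
  set (P := fun t y => exists b u, solves f tau xi b u /\ t < b /\ y = u t).
  set (phi := fun t => epsilon (inhabits 0) (P t)).
  assert (Hphi : forall b u t, solves f tau xi b u -> tau <= t < b -> phi t = u t).
  { intros b u t Hu Ht.
    assert (HP : P t (phi t)).
    { unfold phi. apply epsilon_spec. exists (u t), b, u. split; [auto|]. split; [lra|auto]. }
    destruct HP as [b' [u' [Hu' [Hb' ->]]]]. apply (Hagree b' b); auto; lra. }
  assert (Hsol : forall t, Ico tau T t -> exists b u, t < b /\ Rbar_le b T /\
            solves f tau xi b u /\ forall s, tau <= s < b -> phi s = u s).
  { intros t [Ht HtT]. destruct (lt_Lub_Rbar E t HtT) as [b [[Hb [u Hu]] Htb]].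
    exists b, u. split; auto. split; [apply le_Lub_Rbar; split; eauto|]. split; auto.
    intros s Hs. apply (Hphi b); auto. }
  clearbody phi. clear P Hphi.
  assert (HtauT : Rbar_lt tau T).
  { destruct (solves_local f tau xi Hf) as [b [u [Hb Hu]]].
    apply Rbar_lt_le_trans with b; auto. apply le_Lub_Rbar. split; eauto. }
  assert (Htau : Ico tau T tau) by (split; [lra | auto]).
  assert (Hxi : phi tau = xi).
  { destruct (Hsol tau Htau) as [b [u [Hb [_ [Hu Heq]]]]]. rewrite Heq by lra. apply Hu. }
  assert (Hstrict : strict_increasing_on (Ico tau T) phi).
  { intros s t [Hs _] Ht Hst. destruct (Hsol t Ht) as [b [u [Hb [_ [Hu Heq]]]]].
    rewrite !Heq by lra. apply (solves_strict_increasing f tau xi b); auto; lra. }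
  set (V := fun y => exists t, Ico tau T t /\ y = phi t).
  set (X := Lub_Rbar V).
  (* The supremum is not attained, since [phi] takes a larger value at a later time [r] before
     [T]. *)
  assert (HltX : forall t, Ico tau T t -> Rbar_lt (phi t) X).
  { intros t [Ht HtT]. destruct (Rbar_lt_exists_between t T HtT) as [r [Hr HrT]].
    assert (HIr : Ico tau T r) by (split; [lra | auto]).
    apply Rbar_lt_le_trans with (phi r).
    - simpl. apply Hstrict; auto. split; auto.
    - apply le_Lub_Rbar. exists r; auto. }
  assert (Hmaps : forall t, Ico tau T t -> Ico xi X (phi t)).
  { intros t Ht. split; auto. rewrite <- Hxi.
    destruct (Req_dec tau t) as [<-|Hne]; [lra|]. left. apply Hstrict; auto.
    destruct Ht; lra. }
  assert (HTX : Rbar_max T X = p_infty).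
  { apply Rbar_max_p_infty. apply NNPP. intros Hn.
    assert (HxiX := HltX tau Htau). rewrite Hxi in HxiX.
    destruct T as [c| |] eqn:HT; [| tauto | contradiction].
    destruct X as [x| |] eqn:HX; [| tauto | contradiction].
    simpl in HtauT.
    (* If both suprema were finite, the solutions before [c] would be bounded by [x], so one would
       exist beyond the supremum [c] of the existence times. *)
    destruct (solves_extend f tau xi c x) as [b [u [Hb Hu]]]; auto.
    - intros b Hb. assert (HIb : Ico tau c b) by (split; simpl; lra).
      destruct (Hsol b HIb) as [b' [u [Hb' [Hb'T [Hu Heq]]]]].
      exists u. split; [apply solves_restrict with b'; auto; lra|].
      intros t Ht. rewrite <- Heq by lra. left. apply (HltX t). split; simpl; lra.
    - assert (Hle : Rbar_le b (Lub_Rbar E)) by (apply le_Lub_Rbar; split; [lra | eauto]).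
      fold T in Hle. rewrite HT in Hle. simpl in Hle. lra. }
  assert (Hder : forall t, Ico tau T t ->
            D_in phi (fun s => f s (phi s)) (Ico tau T) t /\
            continue_in (fun s => f s (phi s)) (Ico tau T) t).
  { intros t Ht. destruct (Hsol t Ht) as [b [u [Hb [_ [Hu Heq]]]]]. destruct Ht as [Ht _].
    split.
    - apply (is_derive_D_in phi _ u tau b); auto. rewrite Heq by lra. apply Hu; lra.
    - apply (continuous_continue_in _ (fun s => f s (u s)) tau b); auto.
      + intros s Hs. rewrite Heq; auto.
      + apply continuous_along; auto. eapply solves_continuous; eauto. }
  exists T, phi. split; [|split].
  - split; [auto|]. split; [|split; [auto|split]].
    + split; auto. exists (fun s => f s (phi s)). auto.
    + intros t Ht. apply Hder; auto.
    + apply Rbar_max_p_infty. apply Rbar_max_p_infty in HTX. destruct HTX as [HT|HX]; auto.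
      (* An infinite [X] forces the supremum of [Rabs (phi t)] to be infinite, since
         [phi t <= Rabs (phi t)]. *)
      right. apply Rbar_le_antisym; [apply (proj2 (Lub_Rbar_correct _)); intros ? _; exact I|].
      rewrite <- HX. refine (proj2 (Lub_Rbar_correct V) _ _). intros y [t [Ht ->]].
      apply Rbar_le_trans with (Rabs (phi t)); [apply Rle_abs|].
      apply le_Lub_Rbar. exists t; auto.
  - intros T' phi' [HT' [_ [Hxi' [Hd Hsup]]]].
    assert (Hsol' : forall b : R, Rbar_le b T' -> exists u, solves f tau xi b u /\
              forall t, tau <= t -> u t = phi' t).
    { intros b Hb. apply (D_in_solves f tau xi b T'); auto. }
    assert (Heq' : forall t, Ico tau T t -> Rbar_lt t T' -> phi' t = phi t).
    { intros t Ht HtT'. destruct (Rbar_lt_exists_between t T' HtT') as [b' [Hb' Hb'T]].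
      destruct (Hsol' b' (Rbar_lt_le _ _ Hb'T)) as [u' [Hu' He']].
      destruct (Hsol t Ht) as [b [u [Hb [_ [Hu Heq]]]]]. destruct Ht as [Ht _].
      rewrite <- He', Heq by lra. apply (Hagree b' b); auto. }
    (* If [T < T'], then [phi'] would give an existence time beyond [T]. *)
    assert (HleT : Rbar_le T' T).
    { destruct (Rbar_le_lt_dec T' T) as [|Hlt]; auto. exfalso.
      assert (exists b : R, Rbar_lt T b /\ Rbar_le b T') as [b [HTb HbT']].
      { destruct T as [c| |] eqn:HT; [|contradiction|contradiction].
        destruct (Rbar_lt_exists_between c T' Hlt) as [b [Hb Hb']].
        exists b; split; auto. apply Rbar_lt_le; auto. }
      destruct (Hsol' b HbT') as [u [Hu _]].
      apply (Rbar_lt_not_le _ _ HTb). apply le_Lub_Rbar. split; [|eauto].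
      exact (Rbar_lt_trans tau T b HtauT HTb). }
    (* If [T' < T], then [phi'] would coincide with [phi] before the finite time [T'], hence stay
       between [xi] and [phi T'], against its maximality. *)
    assert (HTT : T' = T).
    { destruct (Rbar_le_lt_or_eq_dec _ _ HleT) as [Hlt|]; auto. exfalso.
      destruct T' as [c| |]; [|contradiction|contradiction].
      apply Rbar_max_p_infty in Hsup. destruct Hsup as [Hsup|Hsup]; [discriminate|].
      assert (Hc : Ico tau T c) by (split; [simpl in HT'; lra | auto]).
      assert (Hle : Rbar_le (Lub_Rbar (fun y => exists t, Ico tau c t /\ y = Rabs (phi' t)))
                      (Rmax (Rabs xi) (Rabs (phi c)))).
      { apply (proj2 (Lub_Rbar_correct _)). intros y [t [[Ht Htc] ->]].
        assert (HIt : Ico tau T t) by (split; [auto | apply Rbar_lt_trans with c; auto]).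
        rewrite (Heq' t HIt Htc). simpl in Htc |- *.
        assert (H1 := proj1 (Hmaps t HIt)). assert (H2 := Hstrict t c HIt Hc Htc).
        assert (H3 := Rmax_l (Rabs xi) (Rabs (phi c))).
        assert (H4 := Rmax_r (Rabs xi) (Rabs (phi c))).
        assert (H5 := Rle_abs (- xi)). rewrite Rabs_Ropp in H5.
        assert (H6 := Rle_abs (phi c)). apply Rabs_le; lra. }
      rewrite Hsup in Hle. contradiction. }
    split; auto. intros t Ht. apply Heq'; auto. rewrite HTT. apply Ht.
  - exists X. split; [auto|]. split; [rewrite <- Hxi; auto|].
    split; [auto|]. split; [|split; [auto|]].
    + split; auto. exists (fun s => f s (phi s)). auto.
    + split; [auto|]. split.
      * intros s t Hs Ht Heq. destruct (Rtotal_order s t) as [H|[H|H]]; auto; exfalso.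
        -- assert (H' := Hstrict s t Hs Ht H). lra.
        -- assert (H' := Hstrict t s Ht Hs H). lra.
      (* As [x < X], some value [phi t] exceeds [x], and the intermediate value theorem on
         [[tau, t]] yields a preimage; the endpoint [x = xi] is treated apart because the theorem
         asks for a strict sign change. *)
      * intros x [Hx HxX]. destruct (lt_Lub_Rbar V x HxX) as [y [[t [Ht ->]] Hxt]].
        destruct (Hsol t Ht) as [b [u [Hb [HbT [Hu Heq]]]]].
        destruct Ht as [Ht HtT].
        rewrite Heq in Hxt by lra. rewrite <- (proj1 Hu) in Hx.
        assert (Hs : exists s, tau <= s <= t /\ u s = x).
        { destruct Hx as [Hx|Hx]; [|exists tau; split; [lra | auto]].
          destruct (Ranalysis5.IVT_interv (fun r => u r - x) tau t) as [s [Hs Hsx]]; try lra.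
          - intros r Hr. apply continuity_pt_filterlim.
            apply (continuous_minus u (fun _ => x)); [|apply continuous_const].
            apply (solves_continuous f tau xi b r u Hu); lra.
          - destruct Ht as [Ht| <-]; [auto | lra].
          - exists s; split; [auto | lra]. }
        destruct Hs as [s [Hs Hsx]]. exists s. split.
        -- split; [lra|]. apply Rbar_le_lt_trans with t; [simpl; lra | auto].
        -- rewrite Heq by lra. auto.
Qed.
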